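(* Let $(\mathcal{X},d_{\mathcal{X}})$ be a separable metric space. Then the following statements are equivalent: (1) $(\mathcal{X},d_{\mathcal{X}})$ is a metric space of negative type. (2) There exists an isometric embedding $\phi:(\mathcal{X},d_{\mathcal{X}}^{1/2})\to\mathcal{H}$ into a separable real Hilbert space $\mathcal{H}$. (3) There exists an isometric embedding $\phi':(\mathcal{X},d_{\mathcal{X}}^{1/2})\to\mathcal{H}'$ into a separable complex Hilbert space $\mathcal{H}'$.
   Context: A metric space $(\mathcal{X},d_{\mathcal{X}})$ is of negative type if $\sum_{i=1}^n\sum_{j=1}^n\alpha_i\alpha_j d_{\mathcal{X}}(x_i,x_j)\le 0$ for all $n\in\mathbb{N}$, all $x_1,\dots,x_n\in\mathcal{X}$ and all $\alpha\in\mathbb{R}^n$ with $\sum_{i=1}^n\alpha_i=0$. An isometric embedding $\phi:(\mathcal{X},d_{\mathcal{X}}^{1/2})\to\mathcal{H}$ into a Hilbert space is a map with $d_{\mathcal{X}}(x,x')=\|\phi(x)-\phi(x')\|_{\mathcal{H}}^2$ for all $x,x'\in\mathcal{X}$. *)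

(* Defs.v *)
From HB Require Import structures.
From mathcomp Require Import all_boot all_order all_algebra.
From mathcomp Require Import complex.
From mathcomp Require Import all_classical all_reals all_analysis.

Set Implicit Arguments.
Unset Strict Implicit.
Unset Printing Implicit Defensive.

Import Order.TTheory GRing.Theory Num.Theory.
Import numFieldNormedType.Exports.

Local Open Scope classical_set_scope.
Local Open Scope ring_scope.

Definition separable_space (T : topologicalType) : Prop :=
  exists2 D : set T, countable D & dense D.

Definition negative_type (R : realType) (X : metricType R) : Prop :=
  forall (n : nat) (x : 'I_n -> X) (a : 'I_n -> R),
    \sum_(i < n) a i = 0 ->
    \sum_(i < n) \sum_(j < n) a i * a j * mdist (x i) (x j) <= 0.

(* The inner product is linear in its first argument and theta-semilinear in
   the second; it is positive definite, and theta-symmetric. *)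
Record hilbertSpace (K : numFieldType) (theta : K -> K) := HilbertSpace {
  hilbert_sort :> completeNormedModType K ;
  inner : {dot hilbert_sort for theta} ;
  inner_normE : forall u : hilbert_sort, inner u u = `|u| ^+ 2
}.

Definition realHilbertSpace (R : realType) := hilbertSpace (@idfun R).

Definition complexHilbertSpace (R : realType) :=
  hilbertSpace (@Num.conj R[i]).

(* phi is an isometry from X, with the square root of its distance, into H. *)
Definition sqrt_isometry (R : realType) (X : metricType R)
    (H : realHilbertSpace R) (phi : X -> H) : Prop :=
  forall x x' : X, mdist x x' = `|phi x - phi x'| ^+ 2.

(* The norm of a normed module over R[i] takes its values in R[i], hence the
   injection of the real-valued distance. *)
Definition sqrt_isometryC (R : realType) (X : metricType R)
    (H : complexHilbertSpace R) (phi : X -> H) : Prop :=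
  forall x x' : X, (mdist x x')%:C%C = `|phi x - phi x'| ^+ 2.

(* Main.v *)
Require Import Defs.
From HB Require Import structures.
From mathcomp Require Import all_boot all_order all_algebra.
From mathcomp Require Import complex zify ring lra.
From mathcomp Require Import all_classical all_reals all_analysis.

Set Implicit Arguments.
Unset Strict Implicit.
Unset Printing Implicit Defensive.

Import Order.TTheory GRing.Theory Num.Theory.
Import numFieldNormedType.Exports.

Local Open Scope classical_set_scope.
Local Open Scope ring_scope.

(** The three statements are linked in a cycle.

    A negative type metric becomes a positive semidefinite kernel once a base
    point o is chosen, namely k(x, y) = (d(x, o) + d(y, o) - d(x, y)) / 2
    ([gromov_kernel_psd]), and d(x, y) = k(x, x) - 2 k(x, y) + k(y, y).  The
    kernel is realized as a Gram matrix by Gaussian elimination (Cholesky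
    factorization) along a dense sequence x_0, x_1, ...: subtracting from the
    current kernel k_n the rank one kernel
    k_n(x, x_n) k_n(y, x_n) / k_n(x_n, x_n) leaves a positive semidefinite
    kernel k_(n+1) that vanishes on x_0, ..., x_n ([deflate_psd],
    [residual_null]).  The removed rank one kernels are f_n(x) f_n(y), so
    f(x) = (f_n(x))_n is square summable, with sum of squares at most k(x, x).
    Since k_n is dominated by k and vanishes at x_0, ..., x_(n-1), the number
    k_n(x, x) is at most d(x, x_i) for all i < n; by density it tends to 0, so
    that nothing is lost in the limit and x |-> f(x) is an isometry of
    (X, d^(1/2)) into l2 ([kernel_dist_cvg]).  The space l2 of square
    summable real sequences is complete ([l2_complete]) and separable
    ([l2_separable]).

    A real Hilbert space H embeds isometrically into its complexification, the
    space H * H seen as H + iH, which is again complete and separable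
    ([complexification_complete], [complexification_separable]).

    Finally, if the a_i are fixed by the conjugation and sum to 0, expanding
    the squares gives
    sum_(i, j) a_i a_j |v_i - v_j|^2 = - 2 |sum_i a_i v_i|^2
    ([sum_dot_sub]), which is nonpositive: an isometry from (X, d^(1/2)) into
    any Hilbert space forces d to be of negative type. *)

(** * Real inner products *)

Section dot_products.
Variables (R : realType) (V : lmodType R) (f : {dot V for (@idfun R)}).

Lemma dotC u v : f u v = f v u.
Proof. by rewrite (hermC f) expr0 mul1r. Qed.

Lemma dot_ge0 u : 0 <= f u u.
Proof.
have [->|/(@neq0_dnorm_gt0 _ _ _ f)/ltW//] := eqVneq u 0.
by rewrite linear0l.
Qed.

Lemma dotZl a u v : f (a *: u) v = a * f u v.
Proof. exact: linearZl_LR. Qed.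

Lemma dotDl u u' v : f (u + u') v = f u v + f u' v.
Proof. exact: linearDl. Qed.

Lemma dotNl u v : f (- u) v = - f u v.
Proof. exact: linearNl. Qed.

Lemma dot_expand a b u v :
  f (a *: u + b *: v) (a *: u + b *: v) =
  a ^+ 2 * f u u + 2 * a * b * f u v + b ^+ 2 * f v v.
Proof.
rewrite dotDl 2!(dotC _ (_ + _)) !dotDl !dotZl !(dotC _ (_ *: _)) !dotZl.
by rewrite (dotC v u); ring.
Qed.

(** The discriminant argument in division free form: the nonnegative number
    f w w, for w = (f v v) u - (f u v) v, is f v v times the difference of the
    two sides. *)
Lemma cauchy_schwarz u v : f u v ^+ 2 <= f u u * f v v.
Proof.
have [->|v0] := eqVneq v 0.
  have f0 w : f w 0 = 0 by exact: linear0r.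
  by rewrite !f0 expr0n mulr0.
have := dot_ge0 (f v v *: u + (- f u v) *: v); rewrite dot_expand.
have := @neq0_dnorm_gt0 _ _ _ f _ v0.
set a := f v v; set b := f u v; set c := f u u => a0.
have -> : a ^+ 2 * c + 2 * a * (- b) * b + (- b) ^+ 2 * a =
  a * (c * a - b ^+ 2) by ring.
by rewrite pmulr_rge0// subr_ge0.
Qed.

Lemma dot_sqrt_triangle u v :
  Num.sqrt (f (u + v) (u + v)) <= Num.sqrt (f u u) + Num.sqrt (f v v).
Proof.
have u0 := sqrtr_ge0 (f u u); have v0 := sqrtr_ge0 (f v v).
rewrite -(@ler_pXn2r _ 2)// ?nnegrE ?sqrtr_ge0 ?addr_ge0//.
rewrite sqrrD !sqr_sqrtr ?dot_ge0//.
have := dot_expand 1 1 u v; rewrite !scale1r => ->.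
have : f u v <= Num.sqrt (f u u) * Num.sqrt (f v v).
  rewrite -sqrtrM ?dot_ge0//; apply: le_trans (ler_norm _) _.
  by rewrite -sqrtr_sqr ler_wsqrtr// cauchy_schwarz.
by lra.
Qed.

End dot_products.

(** * Positive semidefinite kernels and Cholesky factorization *)

Section kernels.
Variables (R : realType) (X : Type).
Implicit Types (k : X -> X -> R) (s : seq (R * X)).

Definition quad_form k s : R :=
  \sum_(p <- s) \sum_(q <- s) p.1 * q.1 * k p.2 q.2.

(** Weighted points are packed in a list, so that adjoining one more point to a
    finite family is a mere cons. *)
Definition psd_kernel k :=
  (forall x y, k x y = k y x) /\ forall s, 0 <= quad_form k s.

Lemma quad_form_cons k a x s : (forall x y, k x y = k y x) ->
  quad_form k ((a, x) :: s) =
  a ^+ 2 * k x x + 2 * a * (\sum_(p <- s) p.1 * k p.2 x) + quad_form k s.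
Proof.
move=> ksym; rewrite /quad_form big_cons/= big_cons/=.
under [X in _ + X = _]eq_bigr do rewrite big_cons/=.
rewrite big_split/= addrA; congr (_ + _).
have -> : \sum_(q <- s) a * q.1 * k x q.2 = a * \sum_(p <- s) p.1 * k p.2 x.
  by rewrite mulr_sumr; apply: eq_bigr => p _; rewrite ksym mulrA.
have -> : \sum_(p <- s) p.1 * a * k p.2 x = a * \sum_(p <- s) p.1 * k p.2 x.
  by rewrite mulr_sumr; apply: eq_bigr => p _; rewrite mulrA (mulrC a).
by ring.
Qed.

Definition quad_form2 k a b x y : R :=
  a ^+ 2 * k x x + 2 * a * b * k x y + b ^+ 2 * k y y.

Lemma psd_kernel2 k a b x y : psd_kernel k -> 0 <= quad_form2 k a b x y.
Proof.
move=> [ksym /(_ [:: (a, x); (b, y)])].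
rewrite !quad_form_cons// !big_cons !big_nil /quad_form big_nil /=.
rewrite /quad_form2 (ksym y x); congr (_ <= _); ring.
Qed.

Lemma psd_kernel_diag k x : psd_kernel k -> 0 <= k x x.
Proof.
move=> /(psd_kernel2 1 0 x x); rewrite /quad_form2.
by rewrite expr1n expr0n/= mulr0 !mul0r !addr0 mul1r.
Qed.

(** The instance of the Cauchy-Schwarz inequality that makes a zero pivot
    harmless: a row with zero diagonal entry vanishes. *)
Lemma psd_kernel_null k x y : psd_kernel k -> k x x = 0 -> k x y = 0.
Proof.
move=> kpsd kx0.
(* With these weights the form is - 4 (k x y)^2, since k x x = 0. *)
have := psd_kernel2 (- (k y y + 1)) (2 * k x y) x y kpsd.
rewrite /quad_form2 kx0.
have -> : (- (k y y + 1)) ^+ 2 * 0 + 2 * - (k y y + 1) * (2 * k x y) * k x y +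
  (2 * k x y) ^+ 2 * k y y = - (4 * k x y ^+ 2) by ring.
rewrite oppr_ge0 pmulr_rle0// => kxy.
by apply/eqP; rewrite -sqrf_eq0 eq_le kxy sqr_ge0.
Qed.

(** One step of symmetric Gaussian elimination with pivot a.  When k a a = 0,
    the quotient is 0 and the step does nothing, as it should: the row of a is
    then already null, by [psd_kernel_null]. *)
Definition deflate k a x y : R := k x y - k x a * k y a / k a a.

(** The form of the deflated kernel on a weighted family s is the form of k on
    s with the pivot adjoined, its weight being the one that minimizes this
    form. *)
Lemma deflate_psd k a : psd_kernel k -> psd_kernel (deflate k a).
Proof.
move=> kpsd; have [ksym kge0] := kpsd; split => [x y|s].
  by rewrite /deflate ksym (mulrC (k x a)).
set L := \sum_(p <- s) p.1 * k p.2 a.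
(* The weight - L / k a a minimizes t |-> t^2 (k a a) + 2 t L. *)
suff -> : quad_form (deflate k a) s = quad_form k ((- L / k a a, a) :: s).
  exact: kge0.
rewrite quad_form_cons// -/L; set c := (k a a)^-1.
(* This form of c (k a a) = 1 remains true for a zero pivot. *)
have cac : c * k a a * c = c.
  rewrite /c; have [->|k0] := eqVneq (k a a) 0; first by rewrite invr0 !mulr0.
  by rewrite mulVf// mul1r.
transitivity (quad_form k s - L * L * c).
  rewrite /quad_form /L mulr_suml mulr_suml -sumrB; apply: eq_bigr => p _.
  rewrite mulr_sumr mulr_suml -sumrB; apply: eq_bigr => q _.
  rewrite /deflate -/c; ring.
have -> : (- L * c) ^+ 2 * k a a = L * L * (c * k a a * c) by ring.
by rewrite cac; ring.
Qed.

Lemma deflate_pivot k a y : psd_kernel k -> deflate k a a y = 0.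
Proof.
move=> kpsd; rewrite /deflate (kpsd.1 y a).
have [k0|k0] := eqVneq (k a a) 0.
  by rewrite (psd_kernel_null y kpsd k0) mulr0 mul0r subr0.
by rewrite mulrAC divff// mul1r subrr.
Qed.

Lemma deflate_null k a x y : (forall y, k x y = 0) -> deflate k a x y = 0.
Proof. by move=> kx; rewrite /deflate !kx !mul0r subr0. Qed.

Variables (k : X -> X -> R) (x_ : nat -> X).
Hypothesis kpsd : psd_kernel k.

Fixpoint residual n : X -> X -> R :=
  if n is m.+1 then deflate (residual m) (x_ m) else k.

(** The n-th column of the Cholesky factor: a square root of the rank one
    kernel removed at step n. *)
Definition coordinate x n : R :=
  residual n x (x_ n) / Num.sqrt (residual n (x_ n) (x_ n)).

Lemma residual_psd n : psd_kernel (residual n).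
Proof. by elim: n => //= n; exact: deflate_psd. Qed.

Lemma residual_null i n y : (i < n)%N -> residual n (x_ i) y = 0.
Proof.
elim: n y => // n IHn y; rewrite ltnS leq_eqVlt => /predU1P[->|ltin] /=.
  exact/deflate_pivot/residual_psd.
by apply: deflate_null => z; exact: IHn.
Qed.

Lemma sum_coordinate n x y :
  \sum_(i < n) coordinate x i * coordinate y i = k x y - residual n x y.
Proof.
elim: n => [|n IHn]; first by rewrite big_ord0 subrr.
rewrite big_ord_recr/= IHn /deflate /coordinate mulrACA -invfM -expr2.
rewrite sqr_sqrtr; last exact/psd_kernel_diag/residual_psd.
by rewrite opprB addrC addrCA addrC -addrA.
Qed.

(** The squared distance between the images of x and y under a feature map of
    the kernel. *)
Definition kernel_dist k x y : R := k x x - 2 * k x y + k y y.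

Lemma kernel_distE k' x y : kernel_dist k' x y = quad_form2 k' 1 (-1) x y.
Proof. by rewrite /kernel_dist /quad_form2; ring. Qed.

Lemma sum_coordinateB n x y :
  \sum_(i < n) (coordinate x i - coordinate y i) ^+ 2 =
  kernel_dist k x y - kernel_dist (residual n) x y.
Proof.
under eq_bigr do rewrite sqrrB !expr2.
rewrite big_split/= sumrB sumrMnl !sum_coordinate /kernel_dist; ring.
Qed.

(** As the residual vanishes at x_ i, its value at (x, x) is the residual
    squared distance from x to x_ i, which elimination can only decrease. *)
Lemma residual_diag_le n i x : (i < n)%N ->
  residual n x x <= kernel_dist k x (x_ i).
Proof.
move=> ltin; have := sum_coordinateB n x (x_ i).
rewrite {2}/kernel_dist ((residual_psd n).1 x) !residual_null//.
rewrite mulr0 subr0 addr0 => /eqP; rewrite eq_sym subr_eq => /eqP ->.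
by rewrite lerDr sumr_ge0// => j _; rewrite sqr_ge0.
Qed.

Hypothesis x_dense :
  forall x (e : R), 0 < e -> exists i, kernel_dist k x (x_ i) < e.

Lemma residual_diag_cvg x : residual n x x @[n --> \oo] --> (0 : R).
Proof.
apply/cvgrPdist_le => e e0; have [i xi] := x_dense x e0.
near=> n; rewrite sub0r normrN ger0_norm; last first.
  exact/psd_kernel_diag/residual_psd.
apply: le_trans (ltW xi); apply: residual_diag_le.
by near: n; exact: nbhs_infty_gt.
Unshelve. all: by end_near. Qed.

Lemma coordinate_sqr_bound x n : \sum_(i < n) coordinate x i ^+ 2 <= k x x.
Proof.
under eq_bigr do rewrite expr2.
by rewrite sum_coordinate gerBl; exact/psd_kernel_diag/residual_psd.
Qed.

(** The error after n steps is the squared distance for the residual kernel; it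
    is squeezed by the parallelogram inequality
    0 <= |u - v|^2 <= 2 (|u|^2 + |v|^2). *)
Lemma kernel_dist_cvg x y :
  \sum_(i < n) (coordinate x i - coordinate y i) ^+ 2 @[n --> \oo]
    --> kernel_dist k x y.
Proof.
have -> : (fun n => \sum_(i < n) (coordinate x i - coordinate y i) ^+ 2) =
    (fun n => kernel_dist k x y - kernel_dist (residual n) x y).
  by apply/funext => n; exact: sum_coordinateB.
have res0 : kernel_dist (residual n) x y @[n --> \oo] --> (0 : R).
  apply: (@squeeze_cvgr _ _ _ _ (fun=> 0)
      (fun n => 2 * (residual n x x + residual n y y))).
  - near=> n; rewrite kernel_distE psd_kernel2/=; last exact: residual_psd.
    have := psd_kernel2 1 1 x y (residual_psd n).
    rewrite -subr_ge0 => s0; rewrite -subr_ge0; move: s0.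
    by rewrite /quad_form2; congr (_ <= _); ring.
  - exact: cvg_cst.
  - rewrite -[X in _ @ _ --> X](mulr0 2); apply: cvgM; first exact: cvg_cst.
    rewrite -[X in _ @ _ --> X](addr0 0).
    by apply: cvgD; exact: residual_diag_cvg.
by rewrite -[X in _ @ _ --> X]subr0; apply: cvgB; first exact: cvg_cst.
Unshelve. all: by end_near. Qed.

End kernels.

(** * The Hilbert space of square summable sequences *)

Section square_summable_sequences.
Variable R : realType.

(** Boundedness of the partial sums of squares is used in place of convergence
    of the series: it is equivalent by monotonicity, and passes to limits
    without further argument. *)
Definition square_summable : {pred nat -> R} :=
  fun u => `[< exists M, forall n, \sum_(i < n) u i ^+ 2 <= M >].

Lemma square_summableP (u : nat -> R) :
  reflect (exists M, forall n, \sum_(i < n) u i ^+ 2 <= M)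
          (u \in square_summable).
Proof. exact: asboolP. Qed.

Lemma square_summable_submod : submod_closed square_summable.
Proof.
split=> [|a u v].
  apply/square_summableP; exists 0 => n.
  by rewrite big1// => i _; rewrite expr0n.
move=> /square_summableP[M uM] /square_summableP[N vN].
apply/square_summableP; exists (2 * a ^+ 2 * M + 2 * N) => n.
apply: (@le_trans _ _ (2 * a ^+ 2 * (\sum_(i < n) u i ^+ 2) +
                       2 * \sum_(i < n) v i ^+ 2)).
  rewrite !mulr_sumr -big_split; apply: ler_sum => i _ /=.
  have -> : (a *: u + v) i = a * u i + v i by [].
  rewrite -subr_ge0; apply: le_trans (sqr_ge0 (a * u i - v i)) _.
  by rewrite le_eqVlt; apply/orP; left; apply/eqP; ring.
by apply: lerD; apply: ler_wpM2l => //; rewrite mulr_ge0// sqr_ge0.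
Qed.

HB.instance Definition _ :=
  GRing.isSubmodClosed.Build R (nat -> R) square_summable
    square_summable_submod.

Record l2 := L2 { l2val :> nat -> R; l2valP : l2val \in square_summable }.

HB.instance Definition _ := [isSub for l2val].
HB.instance Definition _ := [Choice of l2 by <:].
HB.instance Definition _ := [SubChoice_isSubLmodule of l2 by <:].

Implicit Types u v w : l2.

Lemma l2P u v : (forall i, u i = v i) -> u = v.
Proof. by move=> uv; apply/val_inj/funext. Qed.

Lemma l2_summable u v : cvgn (fun n => \sum_(i < n) u i * v i).
Proof.
suff: cvgn (series (fun i => u i * v i)) by rewrite seriesEord.
apply: normed_cvg; apply: nondecreasing_is_cvgn.
  by apply: nondecreasing_series => n _ _; rewrite normr_ge0.
have /square_summableP[M uM] := l2valP u.
have /square_summableP[N vN] := l2valP v.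
exists (M + N) => _ [n _ <-].
have -> : [normed series (fun i => u i * v i)] n =
    \sum_(i < n) `|u i * v i|.
  by rewrite -[LHS]/(series (fun i => `|u i * v i|) n) seriesEord.
apply: le_trans (lerD (uM n) (vN n)); rewrite -big_split/=.
apply: ler_sum => i _; rewrite normrM -(real_normK (num_real (u i))).
rewrite -(real_normK (num_real (v i))).
by have := normr_ge0 (u i); have := normr_ge0 (v i); nra.
Qed.

Definition l2_inner u v : R := limn (fun n => \sum_(i < n) u i * v i).

Lemma l2_innerE u v l :
  \sum_(i < n) u i * v i @[n --> \oo] --> l -> l2_inner u v = l.
Proof. exact: cvg_lim. Qed.

Lemma l2_innerC u v : l2_inner u v = l2_inner v u.
Proof.
by apply: l2_innerE; under eq_fun do under eq_bigr do rewrite mulrC;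
  exact: l2_summable.
Qed.

Lemma l2_inner_linear w : linear_for *%R (l2_inner^~ w).
Proof.
move=> a u v; apply: l2_innerE.
have -> : (fun n => \sum_(i < n) (a *: u + v) i * w i) =
  (fun n => a * (\sum_(i < n) u i * w i) + \sum_(i < n) v i * w i).
  apply/funext => n; rewrite mulr_sumr -big_split; apply: eq_bigr => i _ /=.
  by rewrite mulrA -mulrDl.
apply: cvgD; last exact: l2_summable.
by apply: cvgM; [exact: cvg_cst|exact: l2_summable].
Qed.

Lemma l2_inner_bilinear : bilinear_for *%R (idfun \; *%R) l2_inner.
Proof.
split=> [w|w a u v]; first exact: l2_inner_linear.
by rewrite !(l2_innerC w) l2_inner_linear.
Qed.

Lemma l2_inner_hermitian u v :
  l2_inner u v = (-1) ^+ false * idfun (l2_inner v u).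
Proof. by rewrite expr0 mul1r l2_innerC. Qed.

Lemma l2_inner_ge n u : \sum_(i < n) u i ^+ 2 <= l2_inner u u.
Proof.
under eq_bigr do rewrite expr2.
have nd : nondecreasing_seq (fun n => \sum_(i < n) u i * u i).
  by apply/nondecreasing_seqP => m; rewrite big_ord_recr/= lerDl -expr2 sqr_ge0.
exact: (nondecreasing_cvgn_le nd (@l2_summable u u) n).
Qed.

Lemma l2_inner_le M u :
  (forall n, \sum_(i < n) u i ^+ 2 <= M) -> l2_inner u u <= M.
Proof.
move=> uM; apply: limr_le; first exact: l2_summable.
by near=> n; under eq_bigr do rewrite -expr2.
Unshelve. all: by end_near. Qed.

Lemma l2_inner_gt0 u : u != 0 -> 0 < l2_inner u u.
Proof.
move=> u0; have [i ui0] : exists i, u i != 0.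
  apply/not_existsP => ui; move/eqP: u0; apply.
  by apply: l2P => i; have /negP/negPn/eqP := ui i.
apply: lt_le_trans (l2_inner_ge i.+1 u).
rewrite big_ord_recr/= ltr_wpDl ?sumr_ge0// => [j _|]; first exact: sqr_ge0.
by rewrite exprn_even_gt0.
Qed.

HB.instance Definition _ := @bilinear_isBilinear.Build R l2 l2 R
  *%R (idfun \; *%R) l2_inner l2_inner_bilinear.
HB.instance Definition _ := isHermitianSesquilinear.Build R l2 false idfun
  l2_inner l2_inner_hermitian.
HB.instance Definition _ := isDotProduct.Build R l2 l2_inner l2_inner_gt0.

Definition l2_norm u : R := Num.sqrt (l2_inner u u).

Lemma l2_norm_triangle u v : l2_norm (u + v) <= l2_norm u + l2_norm v.
Proof. exact: (dot_sqrt_triangle (l2_inner : {dot l2 for idfun})). Qed.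

Lemma l2_normZ a u : l2_norm (a *: u) = `|a| * l2_norm u.
Proof.
have := dot_expand (l2_inner : {dot l2 for idfun}) a 0 u 0.
rewrite scaler0 addr0 mulr0 mul0r expr0n mul0r !addr0 /l2_norm => ->.
by rewrite sqrtrM ?sqr_ge0// sqrtr_sqr.
Qed.

Lemma l2_norm0_eq0 u : l2_norm u = 0 -> u = 0.
Proof.
move=> /eqP; rewrite sqrtr_eq0 => uu; apply/eqP.
by apply: contraLR uu => /l2_inner_gt0; rewrite -ltNge.
Qed.

HB.instance Definition _ := Lmodule_isNormed.Build R l2
  l2_norm_triangle l2_normZ l2_norm0_eq0.

Lemma l2_normE u : l2_inner u u = `|u| ^+ 2.
Proof.
rewrite [RHS]sqr_sqrtr//; apply: le_trans (l2_inner_ge 0 u).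
by rewrite big_ord0.
Qed.

Lemma l2_norm_le (e : R) u : 0 <= e ->
  (forall n, \sum_(i < n) u i ^+ 2 <= e ^+ 2) -> `|u| <= e.
Proof.
move=> e0 ue; rewrite -(@ler_pXn2r _ 2)// ?nnegrE// -l2_normE.
exact: l2_inner_le.
Qed.

Lemma sum_sqr_le_l2_norm n u : \sum_(i < n) u i ^+ 2 <= `|u| ^+ 2.
Proof. by rewrite -l2_normE; exact: l2_inner_ge. Qed.

Lemma l2_coord_le u i : `|u i| <= `|u|.
Proof.
rewrite -(@ler_pXn2r _ 2)// ?nnegrE// real_normK ?num_real//.
apply: le_trans (sum_sqr_le_l2_norm i.+1 u); rewrite big_ord_recr/= lerDr.
by apply: sumr_ge0 => j _; exact: sqr_ge0.
Qed.

(** A Cauchy filter converges in each coordinate, to w say.  If almost all v are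
    within e of u, then the partial sums of |u - v|^2 are at most e^2, and v can
    be sent to w in each of these finite sums.  So u - w has norm at most e,
    which shows both that w is square summable and that it is the limit. *)
Lemma l2_complete (F : set_system l2) : ProperFilter F -> cauchy F -> cvg F.
Proof.
move=> FF /cauchy_ballP Fc.
have Fdist (e : R) : 0 < e -> \forall u & v \near F, `|u - v| < e.
  by move=> e0; have := Fc e e0; rewrite /ball/=.
have coord_cvg i : cvg ((fun u : l2 => u i) @ F).
  apply: R_complete; apply/cauchy_ballP => e e0.
  rewrite near_map2; apply: filterS (Fdist e e0) => -[u v] /=.
  by apply: le_lt_trans; exact: (l2_coord_le (u - v) i).
pose w i : R := lim ((fun u : l2 => u i) @ F).
have tail (e : R) : 0 < e ->
    F [set u : l2 | forall n, \sum_(i < n) (u i - w i) ^+ 2 <= e ^+ 2].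
  move=> e0; apply: filterS (nearP_dep (Fdist e e0)) => u uv n.
  apply: (@cvgr_to_le _ F _ _ (fun v : l2 => \sum_(i < n) (u i - v i) ^+ 2)).
    apply: cvg_big => [|i _]; first exact: add_continuous.
    by apply: cvgM; (apply: cvgB; [exact: cvg_cst|exact: coord_cvg]).
  apply: filterS uv => v uv; apply: le_trans (sum_sqr_le_l2_norm n (u - v)) _.
  by rewrite ler_sqr ?nnegrE// ltW.
have [u0 u0w] := filter_ex (tail _ ltr01).
have wl2 : w \in square_summable.
  have dl2 : (u0 : nat -> R) - w \in square_summable.
    by apply/square_summableP; exists (1 ^+ 2).
  by rewrite -(subKr (u0 : nat -> R) w) rpredB// l2valP.
apply/cvg_ex; exists (L2 wl2); apply/cvgrPdist_le => e e0.
apply: filterS (tail e e0) => u uw; rewrite distrC.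
by apply: l2_norm_le => //; exact: ltW.
Qed.

HB.instance Definition _ := Uniform_isComplete.Build l2 l2_complete.

Definition l2_hilbert : realHilbertSpace R :=
  HilbertSpace (hilbert_sort := l2) (inner := l2_inner) l2_normE.

End square_summable_sequences.

(** * Density in normed modules *)

Section density.
Variables (K : numFieldType) (V : normedModType K).

Lemma dense_approx (D : set V) :
  (forall z (e : K), 0 < e -> exists2 w, D w & `|z - w| <= e) -> dense D.
Proof.
move=> Dapprox O [z Oz] oO.
have /nbhs_ballP[e /= e0 zeO] : nbhs z O by exact: open_nbhs_nbhs.
have [|w Dw zw] := Dapprox z (e / 2); first by rewrite divr_gt0.
exists w; split => //; apply: zeO; rewrite -ball_normE /=.
by apply: le_lt_trans zw _; rewrite ltr_pdivrMr// mulr_natr mulr2n ltrDl.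
Qed.

Lemma approx_dense (D : set V) : dense D ->
  forall z (e : K), 0 < e -> exists2 w, D w & `|z - w| < e.
Proof.
move=> dD z e e0.
have [|w [/interior_subset zw Dw]] := dD (ball z e)° _ (open_interior _).
  by exists z; exact: nbhsx_ballx.
by exists w => //; move: zw; rewrite -ball_normE.
Qed.

End density.

(** * Separability of the space of square summable sequences *)

Section l2_separable.
Variable R : realType.

Lemma square_summable_finite (u : nat -> R) N :
  (forall i, u (N + i)%N = 0) -> u \in @square_summable R.
Proof.
move=> u0; apply/square_summableP; exists (\sum_(i < N) u i ^+ 2) => n.
apply: (@le_trans _ _ (\sum_(i < n + N) u i ^+ 2)).
  by rewrite big_split_ord/= lerDl sumr_ge0// => i _; exact: sqr_ge0.
rewrite addnC big_split_ord/= [X in _ + X]big1 ?addr0// => i _.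
by rewrite u0 expr0n.
Qed.

Definition rat_seq_val (s : seq rat) (i : nat) : R := ratr s`_i.

Lemma rat_seq_summable s : rat_seq_val s \in @square_summable R.
Proof.
apply: (@square_summable_finite _ (size s)) => i.
by rewrite /rat_seq_val nth_default ?leq_addr// rmorph0.
Qed.

Definition rat_seq s : l2 R := L2 (rat_seq_summable s).

Lemma rat_approx (x e : R) : 0 < e -> exists q : rat, `|x - ratr q| <= e.
Proof.
move=> e0; have [q] : exists q : rat, ratr q \in `]x - e, x + e[.
  by apply: rat_in_itvoo; rewrite ltrD2l gtrN.
rewrite in_itv/= => /andP[qx xq]; exists q.
by rewrite ler_norml; apply/andP; split; lra.
Qed.

Lemma l2_tail_le (u : l2 R) N n :
  \sum_(i < n) u (N + i)%N ^+ 2 <= `|u| ^+ 2 - \sum_(i < N) u i ^+ 2.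
Proof.
rewrite lerBrDl.
by have := sum_sqr_le_l2_norm (N + n) u; rewrite big_split_ord.
Qed.

(** Finitely supported rational sequences are dense: half of e^2 pays for the
    tail after N, and the other half for the N rational approximations. *)
Lemma rat_seq_approx (u : l2 R) (e : R) : 0 < e ->
  exists s, `|u - rat_seq s| <= e.
Proof.
move=> e0; have e20 : 0 < e ^+ 2 / 2 by rewrite divr_gt0// exprn_gt0.
have [N uN] : exists N, `|u| ^+ 2 - \sum_(i < N) u i ^+ 2 <= e ^+ 2 / 2.
  have uu : \sum_(i < n) u i * u i @[n --> \oo] --> l2_inner u u.
    exact: l2_summable.
  have /cvgrPdist_le/(_ _ e20)[N _ /(_ N (leqnn N))] := uu.
  rewrite l2_normE => uN; exists N; apply: le_trans (ler_norm _) _.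
  by under eq_bigr do rewrite expr2.
(* N d^2 <= e^2 / 2 because 2 N <= (N + 1)^2 *)
pose d : R := e / (N.+1)%:R.
have d0 : 0 < d by rewrite divr_gt0.
have [q uq] := choice (fun i => rat_approx (u i) d0).
exists (mkseq q N); apply: l2_norm_le => [|n]; first exact: ltW.
pose D i : R := u i - ratr (mkseq q N)`_i.
rewrite -[leLHS]/(\sum_(i < n) D i ^+ 2).
apply: (@le_trans _ _ (\sum_(i < N + n) D i ^+ 2)).
  rewrite addnC big_split_ord/= lerDl sumr_ge0// => i _; exact: sqr_ge0.
rewrite big_split_ord/= [leRHS](splitr (e ^+ 2)); apply: lerD; last first.
  apply: le_trans uN; apply: le_trans (l2_tail_le u N n).
  apply: ler_sum => i _; rewrite /D nth_default ?rmorph0 ?subr0//.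
  by rewrite size_mkseq leq_addr.
apply: (@le_trans _ _ (\sum_(i < N) d ^+ 2)).
  apply: ler_sum => i _; rewrite /D nth_mkseq//.
  by rewrite -(real_normK (num_real (_ - _))) ler_sqr ?nnegrE// ltW.
rewrite sumr_const card_ord -[leLHS]mulr_natl /d expr_div_n mulrCA.
rewrite ler_wpM2l ?sqr_ge0// ler_pdivrMr ?exprn_gt0//.
rewrite -ler_pdivrMl ?invr_gt0// invrK -natrM -natrX ler_nat.
by rewrite mul2n -addnn; lia.
Qed.

Lemma l2_separable : separable_space (l2 R).
Proof.
exists (range rat_seq).
  by apply: card_le_trans (card_image_le _ _) _; exact: countableP.
apply: dense_approx => u e /(rat_seq_approx u)[s us].
by exists (rat_seq s).
Qed.

End l2_separable.

(** * Complexification of a real Hilbert space *)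

Section complexification.
Variables (R : realType) (H : realHilbertSpace R).
Local Notation "''[' u , v ]" := (inner H u v).

(** The pair (x, y) stands for x + iy.  The alias keeps this space apart from
    the real normed product H * H, which carries another norm. *)
Definition complexification : Type := (H * H)%type.

HB.instance Definition _ :=
  GRing.Zmodule.copy complexification (H * H)%type.

Implicit Types (z w : complexification) (a b : R[i]).

Definition cscale a z : complexification :=
  (complex.Re a *: z.1 - complex.Im a *: z.2,
   complex.Im a *: z.1 + complex.Re a *: z.2).

Lemma cscaleA a b z : cscale a (cscale b z) = cscale (a * b) z.
Proof.
case: a b z => [a a'] [b b'] [x y]; rewrite /cscale/=; congr (_, _).
  rewrite scalerBr scalerDr !scalerA scalerBl scalerDl !opprD !addrA.
  by congr (_ - _); rewrite addrAC.
rewrite scalerBr scalerDr !scalerA scalerBl scalerDl !addrA.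
by rewrite [X in X + _ = _]addrAC [LHS]addrAC; congr (_ + _ - _); rewrite addrC.
Qed.

Lemma cscale1 : left_id 1 cscale.
Proof. by case=> x y; rewrite /cscale/= !scale1r !scale0r subr0 add0r. Qed.

Lemma cscaleDr : right_distributive cscale +%R.
Proof.
case=> a b [x y] [x' y']; rewrite /cscale/= !scalerDr opprD.
by congr (_, _); rewrite addrACA.
Qed.

Lemma cscaleDl z : {morph cscale^~ z : a b / a + b}.
Proof.
case=> a a' [b b']; rewrite /cscale/= !scalerDl opprD.
by congr (_, _); rewrite addrACA.
Qed.

HB.instance Definition _ := GRing.Zmodule_isLmodule.Build R[i] complexification
  cscaleA cscale1 cscaleDr cscaleDl.

Lemma cscaleE a z : a *: z = cscale a z. Proof. by []. Qed.

Definition cinner z w : R[i] :=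
  Complex ('[z.1, w.1] + '[z.2, w.2]) ('[z.2, w.1] - '[z.1, w.2]).

Lemma cinner_linear w : linear_for *%R (cinner^~ w).
Proof.
case: w => w1 w2 [a b] [x y] [x' y']; rewrite cscaleE /cinner /cscale /=.
rewrite !(dotDl, dotNl, dotZl).
apply/eqP; rewrite eq_complex /=; apply/andP; split; apply/eqP; ring.
Qed.

Lemma cinnerC z w : cinner z w = (-1) ^+ false * Num.conj (cinner w z).
Proof.
rewrite expr0 mul1r /cinner /=; congr Complex.
  by rewrite (dotC _ z.1) (dotC _ z.2).
by rewrite (dotC _ z.1) (dotC _ z.2) opprB.
Qed.

Lemma cinner_semilinear z : linear_for (Num.conj \; *%R) (cinner z).
Proof.
move=> a u v; rewrite cinnerC expr0 mul1r cinner_linear rmorphD rmorphM /=.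
rewrite [in RHS](cinnerC z u) [in RHS](cinnerC z v).
by rewrite !expr0 !mul1r.
Qed.

(** The square root of |x|^2 + |y|^2, written as the modulus of the complex
    number |x| + i|y|: its triangle inequality then follows from that of the
    modulus. *)
Definition cnorm z : R[i] := `|Complex `|z.1| `|z.2| |.

Lemma cnorm_sqr z : cnorm z ^+ 2 = (`|z.1| ^+ 2 + `|z.2| ^+ 2)%:C%C.
Proof.
by rewrite /cnorm normc_def -rmorphXn /= sqr_sqrtr// addr_ge0// sqr_ge0.
Qed.

Lemma cinnerE z : cinner z z = cnorm z ^+ 2.
Proof.
by rewrite cnorm_sqr /cinner (dotC _ z.1 z.2) subrr !inner_normE.
Qed.

Lemma cnorm0_eq0 z : cnorm z = 0 -> z = 0.
Proof.
by case: z => x y /eqP; rewrite normr_eq0 eq_complex/= !normr_eq0 =>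
  /andP[/eqP -> /eqP ->].
Qed.

Lemma cinner_gt0 z : z != 0 -> 0 < cinner z z.
Proof.
move=> z0; rewrite cinnerE exprn_gt0// lt_def normr_ge0 andbT.
by apply: contra_neq z0; exact: cnorm0_eq0.
Qed.

HB.instance Definition _ := @bilinear_isBilinear.Build R[i] complexification
  complexification R[i] *%R (Num.conj \; *%R) cinner
  (cinner_linear, cinner_semilinear).
HB.instance Definition _ := isHermitianSesquilinear.Build R[i] complexification
  false Num.conj cinner cinnerC.
HB.instance Definition _ := isDotProduct.Build R[i] complexification cinner
  cinner_gt0.

Lemma cnormZ a z : cnorm (a *: z) = `|a| * cnorm z.
Proof.
apply/eqP; rewrite -(@eqrXn2 _ 2)// ?mulr_ge0 ?normr_ge0//.
rewrite exprMn -!cinnerE linearZl_LR linearZr_LR /= mulrA.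
by rewrite -normCK.
Qed.

Lemma ler_cnormD z w : cnorm (z + w) <= cnorm z + cnorm w.
Proof.
apply: le_trans (ler_normD _ _); rewrite !normc_def lecR ler_wsqrtr//=.
by apply: lerD; rewrite ler_sqr ?nnegrE ?addr_ge0// ler_normD.
Qed.

HB.instance Definition _ := Lmodule_isNormed.Build R[i] complexification
  ler_cnormD cnormZ cnorm0_eq0.

Lemma cnormE z : cinner z z = `|z| ^+ 2.
Proof. exact: cinnerE. Qed.

Lemma norm_cpair_sqr z : `|z| ^+ 2 = (`|z.1| ^+ 2 + `|z.2| ^+ 2)%:C%C.
Proof. exact: cnorm_sqr. Qed.

Lemma norm_cpair_fst (z : complexification) : (`|z.1|%:C)%C <= `|z|.
Proof.
rewrite -(@ler_pXn2r _ 2)// ?nnegrE// ?lecR//.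
by rewrite norm_cpair_sqr -rmorphXn lecR lerDl sqr_ge0.
Qed.

Lemma norm_cpair_snd (z : complexification) : (`|z.2|%:C)%C <= `|z|.
Proof.
rewrite -(@ler_pXn2r _ 2)// ?nnegrE// ?lecR//.
by rewrite norm_cpair_sqr -rmorphXn lecR lerDr sqr_ge0.
Qed.

Lemma norm_cpair_le (z : complexification) :
  `|z| <= (`|z.1|%:C)%C + (`|z.2|%:C)%C.
Proof.
rewrite -(@ler_pXn2r _ 2)// ?nnegrE// ?addr_ge0 ?lecR//.
rewrite norm_cpair_sqr -rmorphD -rmorphXn lecR/= sqrrD addrAC lerDl.
by rewrite mulrn_wge0// mulr_ge0.
Qed.

Lemma pos_complex (e : R[i]) : 0 < e -> exists2 r : R, 0 < r & e = r%:C%C.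
Proof.
by case: e => a b; rewrite ltcE/= => /andP[/eqP -> a0]; exists a.
Qed.

(** Convergence is componentwise, by the comparison of the norm of x + iy with
    those of x and y. *)
Lemma complexification_complete (F : set_system complexification) :
  ProperFilter F -> cauchy F -> cvg F.
Proof.
move=> FF /cauchy_ballP Fc.
have Fdist (e : R) : 0 < e ->
    \forall z & w \near F, `|(z : complexification) - w| < e%:C%C.
  by move=> e0; have := Fc e%:C%C; rewrite /ball/= ltcR; exact.
have fst_cvg : cvg ((fun z : complexification => z.1) @ F).
  apply: cauchy_cvg; apply/cauchy_ballP => e e0.
  rewrite near_map2; apply: filterS (Fdist e e0) => -[z w] /= zw.
  rewrite -ball_normE /= -ltcR; apply: le_lt_trans zw.
  exact: norm_cpair_fst (z - w).
have snd_cvg : cvg ((fun z : complexification => z.2) @ F).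
  apply: cauchy_cvg; apply/cauchy_ballP => e e0.
  rewrite near_map2; apply: filterS (Fdist e e0) => -[z w] /= zw.
  rewrite -ball_normE /= -ltcR; apply: le_lt_trans zw.
  exact: norm_cpair_snd (z - w).
move/cvg_ex: fst_cvg => [x Fx]; move/cvg_ex: snd_cvg => [y Fy].
apply/cvg_ex; exists ((x, y) : complexification).
apply/cvgrPdist_le => _ /pos_complex[e e0 ->].
have e20 : 0 < e / 2 by rewrite divr_gt0.
move/cvgrPdist_le: Fx => /(_ _ e20) Fx.
move/cvgrPdist_le: Fy => /(_ _ e20) Fy.
apply: filterS2 Fx Fy => z zx zy.
apply: le_trans (norm_cpair_le _) _.
by rewrite -rmorphD lecR [leRHS]splitr lerD.
Qed.

HB.instance Definition _ :=
  Uniform_isComplete.Build complexification complexification_complete.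

Definition complexification_hilbert : complexHilbertSpace R :=
  HilbertSpace (hilbert_sort := complexification) (inner := cinner) cnormE.

Definition complexify (x : H) : complexification := (x, 0).

Lemma norm_complexify x y :
  `|complexify x - complexify y| ^+ 2 = (`|x - y| ^+ 2)%:C%C.
Proof. by rewrite norm_cpair_sqr/= subr0 normr0 expr0n addr0. Qed.

Lemma complexification_separable :
  separable_space H -> separable_space complexification.
Proof.
move=> [D cD dD]; exists (D `*` D : set complexification).
  exact: countableX.
apply: dense_approx => -[x y] _ /pos_complex[e e0 ->].
have e20 : 0 < e / 2 by rewrite divr_gt0.
have [x' Dx' xx'] := approx_dense dD x e20.
have [y' Dy' yy'] := approx_dense dD y e20.
exists (x', y') => //.
apply: le_trans (norm_cpair_le _) _.
by rewrite -rmorphD lecR [leRHS]splitr lerD// ltW.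
Qed.

End complexification.

(** * Negative type of squared Hilbert distances *)

Section negative_type_identity.
Variables (K : numFieldType) (theta : K -> K) (V : lmodType K).
Variable f : {dot V for theta}.

(** In the expansion of the squares, the diagonal terms f (v i) (v i) carry the
    factor \sum_j a j = 0, and only the cross terms remain. *)
Lemma sum_dot_sub n (a : 'I_n -> K) (v : 'I_n -> V) :
  (forall i, theta (a i) = a i) -> \sum_(i < n) a i = 0 ->
  \sum_(i < n) \sum_(j < n) a i * a j * f (v i - v j) (v i - v j) =
  - (f (\sum_(i < n) a i *: v i) (\sum_(i < n) a i *: v i) *+ 2).
Proof.
move=> thetaa a0.
have fE i j : f (v i - v j) (v i - v j) =
    f (v i) (v i) - f (v i) (v j) - f (v j) (v i) + f (v j) (v j).
  by rewrite linearBl !linearBr opprB addrA addrAC.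
have -> : f (\sum_(i < n) a i *: v i) (\sum_(i < n) a i *: v i) =
    \sum_(i < n) \sum_(j < n) a i * a j * f (v i) (v j).
  rewrite linear_sumlz; apply: eq_bigr => i _.
  rewrite linear_sumr; apply: eq_bigr => j _.
  by rewrite linearZl_LR linearZr_LR /= thetaa mulrA.
set S := \sum_(i < n) \sum_(j < n) a i * a j * f (v i) (v j).
transitivity (
  \sum_(i < n) \sum_(j < n) a i * a j * f (v i) (v i) - S
  - \sum_(i < n) \sum_(j < n) a i * a j * f (v j) (v i)
  + \sum_(i < n) \sum_(j < n) a i * a j * f (v j) (v j)).
  rewrite /S -!sumrB -big_split; apply: eq_bigr => i _ /=.
  rewrite -!sumrB -big_split; apply: eq_bigr => j _ /=.
  by rewrite fE mulrDr !mulrBr.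
have -> : \sum_(i < n) \sum_(j < n) a i * a j * f (v j) (v i) = S.
  rewrite exchange_big; apply: eq_bigr => i _; apply: eq_bigr => j _.
  by rewrite (mulrC (a j)).
have diag0 : \sum_(i < n) \sum_(j < n) a i * a j * f (v i) (v i) = 0.
  apply: big1 => i _; under eq_bigr do rewrite mulrAC mulrC.
  by rewrite -mulr_suml a0 mul0r.
rewrite diag0 exchange_big /=; under [X in _ + X]eq_bigr do
  under eq_bigr do rewrite (mulrC (a _) (a _)).
by rewrite diag0 addr0 sub0r -opprD mulr2n.
Qed.

Lemma sum_dot_sub_le0 n (a : 'I_n -> K) (v : 'I_n -> V) :
  (forall i, theta (a i) = a i) -> \sum_(i < n) a i = 0 ->
  \sum_(i < n) \sum_(j < n) a i * a j * f (v i - v j) (v i - v j) <= 0.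
Proof.
move=> thetaa a0; rewrite sum_dot_sub// oppr_le0 mulrn_wge0//.
have [->|/(@neq0_dnorm_gt0 _ _ _ f)/ltW//] :=
  eqVneq (\sum_(i < n) a i *: v i) 0.
by rewrite linear0l.
Qed.

End negative_type_identity.

(** * Embedding a metric space of negative type *)

Section negative_type_kernel.
Variables (R : realType) (X : metricType R).

(** The Gromov product of x and y at o, which plays the role of the inner
    product of x - o and y - o. *)
Definition gromov_kernel (o x y : X) : R :=
  (mdist x o + mdist y o - mdist x y) / 2.

Lemma kernel_dist_gromov o x y : kernel_dist (gromov_kernel o) x y = mdist x y.
Proof. by rewrite /kernel_dist /gromov_kernel !mdistxx; field. Qed.

Lemma negative_type_seq (s : seq (R * X)) : negative_type X ->
  \sum_(p <- s) p.1 = 0 -> quad_form mdist s <= 0.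
Proof.
move=> Xneg; rewrite /quad_form !(big_tnth _ _ s) => s0.
under eq_bigr do rewrite big_tnth.
exact: (Xneg _ (fun i => (tnth (in_tuple s) i).2)
               (fun i => (tnth (in_tuple s) i).1)).
Qed.

(** Given arbitrary weights of total A, the weight - A at o completes them to
    weights of sum 0, on which the form of the distance is - 2 times that of
    the kernel. *)
Lemma gromov_kernel_psd o : negative_type X -> psd_kernel (gromov_kernel o).
Proof.
move=> Xneg; split => [x y|s].
  by rewrite /gromov_kernel (metric_sym x y) [mdist x o + _]addrC.
set A := \sum_(p <- s) p.1; set L := \sum_(p <- s) p.1 * mdist p.2 o.
have : quad_form mdist ((- A, o) :: s) <= 0.
  by apply: negative_type_seq => //; rewrite big_cons /= addNr.
rewrite quad_form_cons; last exact: metric_sym.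
rewrite mdistxx mulr0 add0r -/L.
suff -> : quad_form (gromov_kernel o) s = A * L - quad_form mdist s / 2 by lra.
transitivity (L * A / 2 + A * L / 2 - quad_form mdist s / 2); last by field.
rewrite /quad_form /gromov_kernel {1}/L {2}/A !mulr_suml -big_split -sumrB.
apply: eq_bigr => p _ /=.
rewrite /A /L !mulr_sumr !mulr_suml -big_split -sumrB.
by apply: eq_bigr => q _ /=; field.
Qed.

Lemma separable_dense_seq (o : X) : separable_space X ->
  exists x_ : nat -> X, forall x (e : R), 0 < e -> exists i, mdist x (x_ i) < e.
Proof.
move=> [D /countable_injP[g ginj] dD].
exists (fun n => xget o [set y | D y /\ g y = n]) => x e e0.
have [|y [/interior_subset xy Dy]] := dD (ball x e)° _ (open_interior _).
  by exists x; exact: nbhsx_ballx.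
exists (g y); case: xgetP => [z _ [Dz gz]|/(_ y)/not_andP[]//].
rewrite (ginj z y) ?inE//.
by move: xy; rewrite ballEmdist.
Qed.

End negative_type_kernel.

Section l2_embedding.
Variables (R : realType) (X : Type) (k : X -> X -> R) (x_ : nat -> X).
Hypothesis kpsd : psd_kernel k.

Lemma coordinate_summable x : coordinate k x_ x \in @square_summable R.
Proof.
by apply/square_summableP; exists (k x x) => n; exact: coordinate_sqr_bound.
Qed.

Definition feature_map x : l2 R := L2 (coordinate_summable x).

Lemma norm_feature_map x y :
  (forall x (e : R), 0 < e -> exists i, kernel_dist k x (x_ i) < e) ->
  `|feature_map x - feature_map y| ^+ 2 = kernel_dist k x y.
Proof.
move=> x_dense; rewrite -l2_normE; apply: l2_innerE.
under eq_fun do under eq_bigr do rewrite -expr2.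
exact: kernel_dist_cvg.
Qed.

End l2_embedding.

(** * The equivalence *)

Theorem theorem3p7 (R : realType) (X : metricType R)
    (hX : separable_space X) :
  [<-> negative_type X;
       exists (H : realHilbertSpace R) (phi : X -> H),
         separable_space H /\ sqrt_isometry phi;
       exists (H' : complexHilbertSpace R) (phi' : X -> H'),
         separable_space H' /\ sqrt_isometryC phi'].
Proof.
tfae.
- move=> Xneg; exists (l2_hilbert R).
  (* A base point exists unless X is empty, where any map will do. *)
  have [[x0 _]|noX] := pselect (exists o : X, True); last first.
    exists (fun=> 0); split; first exact: l2_separable.
    by move=> x; case: noX; exists x.
  have [x_ x_dense] := separable_dense_seq x0 hX.
  have kpsd := gromov_kernel_psd x0 Xneg.
  exists (feature_map x_ kpsd); split => [|x y]; first exact: l2_separable.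
  rewrite norm_feature_map ?kernel_dist_gromov// => z e e0.
  by have [i zi] := x_dense z e e0; exists i; rewrite kernel_dist_gromov.
- move=> [H [phi [sepH phiE]]].
  exists (complexification_hilbert H), (fun x => complexify (phi x)); split.
    exact: complexification_separable.
  by move=> x y; rewrite norm_complexify -phiE.
- move=> [H [phi [_ phiE]]] n x a a0; rewrite -lecR rmorph0 rmorph_sum /=.
  under eq_bigr do rewrite rmorph_sum /=.
  under eq_bigr do under eq_bigr do rewrite !rmorphM /= phiE -inner_normE.
  apply: (@sum_dot_sub_le0 _ _ _ (inner H) n (fun i => (a i)%:C%C)
    (fun i => phi (x i))) => [i|]; last by rewrite -rmorph_sum a0.
  exact: conjc_real.
Qed.
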